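(* Let $G$ be a $(d,k)$-graph of size $n\ge(1-\varepsilon)\mu_{d,k}$, for some constant $k>0$. Then $$\lambda(G)\le O(\varepsilon^{1/k})\cdot d ,$$ where the constant implied by the $O$-notation may depend on the constant $k$, but not on $d$, $\varepsilon$, $n$ or $G$.
   Context: A $(d,k)$-graph is an undirected $d$-regular graph of diameter $k$ (the maximum distance between any two vertices is $k$); its size $n$ is its number of vertices. The Moore Bound is $\mu_{d,k}:=1+d\sum_{i=0}^{k-1}(d-1)^i$, which is an upper bound on the size of any $(d,k)$-graph. The parameter $\varepsilon$ is a real number (necessarily $\varepsilon\ge 0$ whenever it is chosen so that $n=(1-\varepsilon)\mu_{d,k}$, since $n\le\mu_{d,k}$). If $\lambda_1\ge\lambda_2\ge\dots\ge\lambda_n$ are the eigenvalues of the adjacency matrix of $G$ (so $\lambda_1=d$), then $\lambda(G):=\max\{|\lambda_2|,|\lambda_n|\}$.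
   Formalization: The bound is proved for ε > 0 and d ≥ ε^(-2/k) (i.e. ε^{1/k}d ≥ √d); without such a condition it is false, e.g. for K_{d+1} with k = 1 and ε = 0, where λ(G) = 1. *)

(* Defs.v *)
From HB Require Import structures.
From mathcomp Require Import all_boot all_order all_algebra complex.
From mathcomp Require Import all_classical all_reals exp.

Set Implicit Arguments.
Unset Strict Implicit.
Unset Printing Implicit Defensive.

Import Order.TTheory GRing.Theory Num.Theory.

Local Open Scope ring_scope.

Definition walk (T : finType) (e : rel T) (m : nat) (x y : T) : bool :=
  [exists p : m.-tuple T, path e x p && (last x p == y)].

(* A shortest walk has fewer than #|T| edges; if there is no walk from x to y,
   [find] returns the size #|T| of the list searched. *)
Definition gdist (T : finType) (e : rel T) (x y : T) : nat :=
  find (fun m => walk e m x y) (iota 0 #|T|).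

Definition diameter (T : finType) (e : rel T) : nat :=
  \max_(x : T) \max_(y : T) gdist e x y.

Record dk_graph (d k : nat) (T : finType) (e : rel T) : Prop := DkGraph {
  dk_sym : symmetric e;
  dk_irr : irreflexive e;
  dk_regular : forall x, #|[set y | e x y]| = d;
  dk_connected : forall x y, connect e x y;
  dk_diameter : diameter e = k }.

Definition moore_bound (d k : nat) : nat :=
  (1 + d * \sum_(i < k) (d - 1) ^ i)%N.

Definition adjmx (R : realType) (T : finType) (e : rel T) : 'M[R]_#|T| :=
  \matrix_(i, j) (e (enum_val i) (enum_val j))%:R.

(* s lists the eigenvalues of A in nonincreasing order, each repeated according
   to its multiplicity. *)
Definition is_spectrum (R : realType) (n : nat) (A : 'M[R]_n) (s : seq R) :
    Prop :=
  sorted >=%R s /\ char_poly A = \prod_(a <- s) ('X - a%:P).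

(* s is indexed from 0, so that the n-th eigenvalue of the literature is
   s`_n.-1. *)
Definition graph_lambda (R : realType) (s : seq R) : R :=
  Num.max `|s`_1| `|s`_(size s).-1|.

Lemma sym_spectrum_exists (R : realType) (n : nat) (A : 'M[R]_n) :
  A^T = A -> exists s, is_spectrum A s.
Proof.
move=> symA; pose f : {rmorphism R -> R[i]} := real_complex R.
pose B := map_mx f A.
have [rs Brs] := closed_field_poly_normal (char_poly B).
move: Brs; rewrite (monicP (char_poly_monic B)) scale1r => Brs.
have conjB : map_mx Num.conj B = B.
  by apply/matrixP => i j; rewrite !mxE; apply: conj_Creal; rewrite complex_real.
have Bt : B^T = B by rewrite /B -{2}symA; apply/matrixP => i j; rewrite !mxE.
have rs_real a : a \in rs -> a \is Num.real.
  move=> ars; have : eigenvalue B a.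
    by rewrite eigenvalue_root_char Brs root_prod_XsubC.
  case/eigenvalueP => v vB v0.
  pose w := (map_mx Num.conj v)^T.
  have Bw : B *m w = Num.conj a *: w.
    by rewrite /w -[in LHS]Bt -trmx_mul -[X in _ *m X]conjB -map_mxM vB
               map_mxZ linearZ.
  have vw : (v *m w) 0 0 != 0.
    apply: contra v0 => /eqP; rewrite mxE => vw0.
    apply/eqP/rowP => j; rewrite mxE; apply/eqP.
    have := @psumr_eq0P _ _ xpredT _ _ vw0.
    move=> /(_ _ j isT) vj; rewrite -normr_eq0 -sqrf_eq0 normCK.
    rewrite -[X in _ * X](_ : w j 0 = _) ?vj //; last by rewrite !mxE.
    by move=> i _; rewrite !mxE -normCK exprn_ge0.
  have : a *: (v *m w) = Num.conj a *: (v *m w).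
    by rewrite scalemxAl -vB -mulmxA Bw scalemxAr.
  move=> /matrixP/(_ 0 0); rewrite [LHS]mxE [RHS]mxE => /(mulIf vw) aE.
  by rewrite CrealE -aE.
pose s := [seq complex.Re a | a <- rs].
have frs : rs = [seq f a | a <- s].
  rewrite -map_comp -[LHS]map_id; apply/eq_in_map => a /rs_real ar /=.
  by rewrite RRe_real.
exists (sort >=%R s); split; first by apply: sort_sorted => x y; exact: le_total.
rewrite (perm_big s) ?perm_sort //=; apply: (map_poly_inj f).
rewrite map_char_poly -/B Brs frs rmorph_prod big_map.
by apply: eq_bigr => a _; rewrite rmorphB /= map_polyX map_polyC.
Qed.

(* Main.v *)
(* Let N_m be the matrix counting non-backtracking walks of length m. Diameter k
   makes every entry of N_0 + ... + N_k at least 1, and its row sums equal the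
   Moore bound mu, so subtracting the all-ones matrix leaves a nonnegative
   matrix with row sums mu - n <= eps * mu. For an eigenvalue a of A with an
   eigenvector orthogonal to 1 this gives |f_0(a) + ... + f_k(a)| <= eps * mu,
   where f_m(A) = N_m. The recurrence f_(m+2) = a f_(m+1) - (d - 1) f_m (with d
   instead of d - 1 for m = 0) shows
   that the left side is at least (|a|/2)^k / 2 as soon as a^2 >= 36 d, while
   mu <= (k + 1) d^k. If a^2 <= 36 d, the assumption eps^(-2/k) <= d already
   gives |a| <= 6 eps^(1/k) d. *)
Require Import Defs.
From mathcomp Require Import all_boot all_order all_algebra.
From mathcomp Require Import all_classical all_reals exp.
From mathcomp Require Import lra.
Import Order.TTheory GRing.Theory Num.Theory.
Local Open Scope ring_scope.

(** * Non-backtracking walks and distances in a regular graph *)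

Section NonBacktracking.
Local Open Scope nat_scope.
Context {T : finType} (e : rel T).

(* Non-backtracking walks of length m.+1 from x whose last step is y -> z. *)
Fixpoint nb_arc (m : nat) (x y z : T) : nat :=
  if m is m'.+1 then e y z * \sum_(u | u != z) nb_arc m' x u y
  else (x == y) && e y z.

Definition nb_walks (m : nat) (x z : T) : nat :=
  if m is m'.+1 then \sum_y nb_arc m' x y z else x == z.

Lemma nb_arc_edge m x y z : e y z * nb_arc m x y z = nb_arc m x y z.
Proof.
case: m => [|m] /=; first by rewrite mulnb andbCA andbb.
by rewrite mulnA mulnb andbb.
Qed.

Lemma nb_arc_gt0_edge {m x y z} : 0 < nb_arc m x y z -> e y z.
Proof. by rewrite -nb_arc_edge; case: (e y z). Qed.

Lemma sum_edges (d : nat) (z : T) : #|[set y | e z y]| = d -> \sum_y e z y = d.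
Proof.
move=> <-; rewrite -sum1dep_card [RHS]big_mkcond.
by apply: eq_bigr => y _; case: (e z y).
Qed.

Lemma sum_edges_neq (d : nat) (u z : T) :
  #|[set y | e z y]| = d -> e z u -> \sum_(y | y != u) e z y = d - 1.
Proof.
by move=> /sum_edges <- ezu; rewrite [in RHS](bigD1 u) //= ezu addKn.
Qed.

(** A walk whose last step is [u -> z] extends to the [d - 1] neighbours of [z] other than [u]. *)
Lemma sum_nb_arc (d m : nat) (x z : T) :
    (forall z, #|[set y | e z y]| = d) -> symmetric e ->
  \sum_y e z y * \sum_(u | u != y) nb_arc m x u z
    = (d - 1) * nb_walks m.+1 x z.
Proof.
move=> reg sym_e.
under eq_bigr => y _ do rewrite big_mkcond big_distrr /=.
rewrite exchange_big big_distrr; apply: eq_bigr => u _ /=.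
have [|] := posnP (nb_arc m x u z) => [->|/nb_arc_gt0_edge euz].
  by rewrite muln0 big1 // => y _; rewrite if_same muln0.
rewrite -(sum_edges_neq d u z (reg z)) 1?sym_e // [in RHS]big_mkcond big_distrl /=.
by apply: eq_bigr => y _; rewrite eq_sym; case: (y != u); rewrite ?mul0n ?muln0.
Qed.

(** The edge [y -> z] either extends the walk or undoes a last step [z -> y]. In the second case the
    shorter walk ends at [z] and [y] ranges over its [d - 1] extensions, or over all [d] neighbours
    when [m = 0], where no earlier step exists. *)
Lemma nb_walksSS (d m : nat) (x z : T) :
    (forall z, #|[set y | e z y]| = d) -> symmetric e ->
  \sum_y nb_walks m.+1 x y * e y z
    = nb_walks m.+2 x z + (d - (0 < m)) * nb_walks m x z.
Proof.
move=> reg sym_e.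
have -> : \sum_y nb_walks m.+1 x y * e y z =
    \sum_y (nb_arc m.+1 x y z + e z y * nb_arc m x z y).
  apply: eq_bigr => y _ /=; rewrite (bigD1 z) //= mulnC mulnDr addnC.
  by rewrite [in e y z * _ z y]sym_e.
rewrite big_split /=; congr addn.
case: m => [|m] /=; last first.
  rewrite -[in RHS](sum_nb_arc d m x z reg sym_e); apply: eq_bigr => y _.
  by rewrite mulnA mulnb andbb.
rewrite subn0 mulnC -[in RHS](sum_edges _ _ (reg z)) big_distrr /=.
by apply: eq_bigr => y _; rewrite !mulnb andbCA andbb.
Qed.

Lemma sum_nb_walks (d m : nat) (x : T) :
    (forall z, #|[set y | e z y]| = d) -> symmetric e ->
  \sum_z nb_walks m.+1 x z = d * (d - 1) ^ m.
Proof.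
move=> reg sym_e; elim: m => [|m IHm] /=.
  rewrite muln1 exchange_big (bigD1 x) //= [X in _ + X]big1 ?addn0.
    by rewrite -[RHS](sum_edges _ _ (reg x)); apply: eq_bigr => z _; rewrite eqxx.
  by move=> y /negPf yx; rewrite big1 // => z _; rewrite eq_sym yx.
rewrite expnS mulnCA -IHm big_distrr [LHS]exchange_big; apply: eq_bigr => y _ /=.
exact: sum_nb_arc.
Qed.

(* Appending an edge to a non-backtracking walk either gives a longer one or
   undoes its last step. *)
Lemma walk_nb_walks (x : T) (p : seq T) : path e x p ->
  exists2 m, m <= size p & 0 < nb_walks m x (last x p).
Proof.
have sum_gt0 (P : pred T) (F : T -> nat) (y : T) :
    P y -> 0 < F y -> 0 < \sum_(i | P i) F i.
  by move=> Py Fy; rewrite (bigD1 y) //= addn_gt0 Fy.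
elim/last_ind: p => [|p z IHp] /=; first by exists 0; rewrite /= ?eqxx.
rewrite rcons_path last_rcons size_rcons => /andP[/IHp[m mp xy] yz] {IHp}.
set y := last x p in xy yz.
case: m => [|m] in mp xy.
  have xyE : x == y by move: xy => /=; case: (x == y).
  by exists 1 => //=; apply: (sum_gt0 _ _ y) => //=; rewrite xyE yz.
move: xy => /=; rewrite lt0n sum_nat_eq0 => /forallPn[u] /=; rewrite -lt0n => uy.
have [uz|uz] := eqVneq u z; last first.
  exists m.+2 => //; apply: (sum_gt0 _ _ y) => //=.
  by rewrite yz mul1n; apply: (sum_gt0 _ _ u).
rewrite {}uz in uy; case: m => [|m] in mp uy.
  by exists 0 => //; move: uy => /=; case: (x == z).
exists m.+1; first by rewrite ltnW // ltnW.
move: uy => /=; rewrite muln_gt0 => /andP[_].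
by rewrite !lt0n; apply: contra; rewrite !sum_nat_eq0 => /forallP h;
  apply/forallP => t; apply/implyP => _; exact: (h t).
Qed.

End NonBacktracking.

(** A duplicate-free path has fewer than [#|T|] edges, so the search in [gdist] succeeds and does
    not return its default value. *)
Lemma walk_of_diameter (T : finType) (e : rel T) (x y : T) : connect e x y ->
  exists p, [/\ path e x p, last x p = y & (size p <= diameter e)%N].
Proof.
move=> /connectP[p0 p0P ->]; case: (shortenP p0P) => p pP pU _ {p0 p0P}.
set z := last x p.
have walkx : has (fun m => walk e m x z) (iota 0 #|T|).
  apply/hasP; exists (size p).
    by rewrite mem_iota add0n; have := max_card (mem (x :: p)); rewrite (card_uniqP pU).
  by apply/existsP; exists (in_tuple p); rewrite pP eqxx.
have dist_lt : (gdist e x z < #|T|)%N.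
  by move: walkx; rewrite has_find size_iota.
have : walk e (gdist e x z) x z.
  by have := nth_find 0%N walkx; rewrite nth_iota.
move=> /existsP[q /andP[qP /eqP qz]]; exists q; split=> //; rewrite size_tuple.
exact: leq_trans (leq_bigmax z) (leq_bigmax x).
Qed.

(** * Linear algebra: rank-one updates, spectra, row sums *)

(* With M = 'X - A and p = 'X - a one has M (p - u w) = p (M - u w); the
   determinant of p - u w is read off the bordered matrix K. *)
Lemma char_poly_rank1_update (F : fieldType) (n : nat) (A : 'M[F]_n)
    (u : 'cV_n) (w : 'rV_n) (a : F) : A *m u = a *: u ->
  char_poly (A + u *m w) * ('X - a%:P) =
    char_poly A * ('X - (a + (w *m u) 0 0)%:P).
Proof.
move=> Au; pose p : {poly F} := 'X - a%:P.
pose M := char_poly_mx A; pose U := map_mx polyC u; pose W := map_mx polyC w.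
have MU : M *m U = p *: U.
  by rewrite /M /char_poly_mx mulmxBl mul_scalar_mx -map_mxM Au map_mxZ scalerBl.
have -> : char_poly (A + u *m w) = \det (M - U *m W).
  by rewrite /char_poly /char_poly_mx map_mxD map_mxM opprD addrA.
have -> : 'X - (a + (w *m u) 0 0)%:P = p - (W *m U) 0 0.
  by rewrite polyCD opprD addrA -map_mxM [in RHS]mxE.
have detM : \det M * \det (p%:M - U *m W) = p ^+ n * \det (M - U *m W).
  rewrite -det_mulmx mulmxBr mulmxA MU mul_mx_scalar -scalemxAl -scalerBr.
  by rewrite detZ.
pose K := block_mx (p%:M : 'M_n) U W (1%:M : 'M_1).
have detK : \det K = \det (p%:M - U *m W).
  have := congr1 determinant (mulmx_block p%:M U W 1%:M 1%:M 0 (- W) 1%:M).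
  rewrite det_mulmx det_lblock !det1 !mulr1 -/K => ->.
  rewrite !mulmx1 !mulmx0 !mul1mx !mulmxN subrr !add0r det_ublock det1.
  by rewrite mulr1.
(* Clearing [W] from the left, at the cost of a factor [p], avoids inverting [p]. *)
have detpK : p * \det K = p ^+ n * (p - (W *m U) 0 0).
  have := congr1 determinant (mulmx_block 1%:M 0 (- W) p%:M p%:M U W 1%:M).
  rewrite det_mulmx det_lblock det1 det_scalar1 mul1r -/K => ->.
  rewrite !mul1mx !mul0mx !mulmx1 !mulNmx mul_mx_scalar mul_scalar_mx addNr.
  rewrite !addr0 det_ublock det_scalar; congr (_ * _).
  by rewrite [_ + _]mx11_scalar det_scalar1 !mxE eqxx mulr1n addrC.
have p0 : p ^+ n != 0 by rewrite expf_neq0 // polyXsubC_eq0.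
apply: (mulfI p0); rewrite mulrA -detM -detK -mulrA [_ * p]mulrC detpK.
by rewrite mulrCA.
Qed.

(* Adding J / n to A moves one copy of the eigenvalue d to d + 1 and keeps the
   rest of the spectrum, so that a remaining eigenvalue, even if equal to d, has
   an eigenvector orthogonal to 1. *)
Lemma spectrum_tail_eigenvector (R : realType) (n : nat) (A : 'M[R]_n)
    (s : seq R) (d : R) (i : nat) :
    is_spectrum A s -> A *m const_mx 1 = d *: (const_mx 1 : 'cV_n) ->
    (forall a, eigenvalue A a -> a <= d) -> (0 < i < size s)%N ->
  exists v : 'rV_n,
    [/\ v != 0, v *m A = s`_i *: v & v *m (const_mx 1 : 'cV_n) = 0].
Proof.
move=> [s_sorted charA] A1 leAd /andP[i0 si].
have sz : size s = n.
  by apply/eqP; rewrite -eqSS -(size_char_poly A) charA size_prod_XsubC.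
have n0 : n%:R != 0 :> R by rewrite pnatr_eq0 -lt0n -sz (ltn_trans i0).
have les a : a \in s -> a <= d.
  by move=> sa; apply: leAd; rewrite eigenvalue_root_char charA root_prod_XsubC.
pose u : 'cV[R]_n := const_mx 1; pose w : 'rV[R]_n := const_mx n%:R^-1.
have wu : (w *m u) 0 0 = 1.
  rewrite mxE; under eq_bigr => j _ do rewrite !mxE mulr1.
  by rewrite sumr_const card_ord -[_ *+ _]mulr_natl divff.
have := char_poly_rank1_update R n A u w d A1; rewrite wu => upd.
have s0 : s`_0 = d.
  have ds : d \in s.
    rewrite -root_prod_XsubC -charA.
    have : root (char_poly A * ('X - (d + 1)%:P)) d.
      by rewrite -upd rootM root_XsubC eqxx orbT.
    rewrite rootM root_XsubC => /orP[//|/eqP]; lra.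
  apply/eqP; rewrite eq_le les ?mem_nth ?(ltn_trans i0) //=.
  case: s s_sorted ds {charA les sz si} => // b s; rewrite inE /=.
  move=> /(order_path_min (rev_trans le_trans)) /allP h /orP[/eqP->//|/h].
  by [].
case: s s0 sz charA les si s_sorted => [//|b s] /= -> _ charA les si _.
case: i i0 si => // i _; rewrite ltnS /= => si.
have : root (char_poly (A + u *m w)) s`_i.
  suff -> : char_poly (A + u *m w) =
      (\prod_(a <- s) ('X - a%:P)) * ('X - (d + 1)%:P).
    by rewrite rootM root_prod_XsubC mem_nth.
  have p0 : 'X - d%:P != 0 :> {poly R} by rewrite polyXsubC_eq0.
  by apply: (mulIf p0); rewrite upd charA big_cons -mulrA mulrC.
rewrite -eigenvalue_root_char => /eigenvalueP[v vA v0].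
(* Applied to [u], the eigenvector equation says that the eigenvalue is [d + 1] or [v *m u = 0];
   entries of [s] are at most [d]. *)
have vu : v *m u = 0.
  have : (v *m (A + u *m w)) *m u = s`_i *: (v *m u) by rewrite vA scalemxAl.
  rewrite -mulmxA mulmxDl A1 -mulmxA [w *m u]mx11_scalar wu mulmx1 -/u.
  rewrite mulmxDr -scalemxAr -[X in _ + X]scale1r -scalerDl => /eqP.
  rewrite -subr_eq0 -scalerBl scaler_eq0 => /orP[/eqP h|/eqP //].
  have /les : s`_i \in d :: s by rewrite inE mem_nth ?orbT.
  by move/eqP: h; rewrite subr_eq0 => /eqP <-; rewrite gerDl ler10.
exists v; split=> //.
by move: vA; rewrite mulmxDr mulmxA vu mul0mx addr0.
Qed.

(** Right multiplication by [M] scales the l1 norm of a row vector by at most [r]. *)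
Lemma eigenvalue_row_sum_bound (R : realDomainType) (n : nat) (M : 'M[R]_n)
    (r a : R) (v : 'rV_n) :
    (forall i j, 0 <= M i j) -> (forall i, \sum_j M i j <= r) ->
  v *m M = a *: v -> v != 0 -> `|a| <= r.
Proof.
move=> M0 Mr vM v0.
have v_gt0 : 0 < \sum_i `|v 0 i|.
  have [j vj] : exists j, v 0 j != 0.
    by apply/existsP; apply: contraR v0 => /existsPn h;
      apply/eqP/rowP => j; rewrite mxE; apply/eqP; move: (h j); rewrite negbK.
  rewrite (bigD1 j) //= ltr_wpDr ?normr_gt0 //; exact: sumr_ge0.
rewrite -(ler_pM2r v_gt0) mulr_sumr.
have -> : \sum_j `|a| * `|v 0 j| = \sum_j `|\sum_i v 0 i * M i j|.
  apply: eq_bigr => j _; rewrite -normrM; congr `|_|.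
  by move/matrixP/(_ 0 j): vM; rewrite !mxE.
apply: (@le_trans _ _ (\sum_j \sum_i `|v 0 i| * M i j)).
  apply: ler_sum => j _; apply: le_trans (ler_norm_sum _ _ _) _.
  by apply: ler_sum => i _; rewrite normrM (ger0_norm (M0 _ _)).
rewrite exchange_big mulr_sumr; apply: ler_sum => i _ /=.
by rewrite -mulr_sumr mulrC ler_wpM2r.
Qed.

(** * Growth of the recurrence at a large scalar *)

(* The value at the scalar [a] of the polynomial that sends the adjacency matrix
   to the matrix counting non-backtracking walks of length m. *)
Fixpoint nb_value (R : realType) (d : nat) (a : R) (m : nat) : R :=
  if m is m'.+1 then
    if m' is m''.+1 then
      a * nb_value R d a m' - (d - (0 < m''))%:R * nb_value R d a m''
    else a
  else 1.

(** By induction the subtracted term is at most [a ^+ 2 / 36 * |f_m| <= |a| / 18 * |f_(m+1)|], well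
    below half of [|a| * |f_(m+1)|]. *)
Lemma nb_value_growth (R : realType) (d : nat) (a : R) (m : nat) :
    36 * d%:R <= a ^+ 2 -> (0 < d)%N ->
  `|a| / 2 * `|nb_value R d a m| <= `|nb_value R d a m.+1|.
Proof.
move=> da d0; have d1 : 1 <= d%:R :> R by rewrite ler1n.
have a0 : 0 <= `|a| by [].
have {}da : 36 * d%:R <= `|a| ^+ 2 by rewrite real_normK ?num_real.
elim: m => [|m IHm]; first by rewrite normr1 /=; lra.
set f1 := nb_value R d a m.+1 in IHm *.
have -> : nb_value R d a m.+2 =
    a * f1 - (d - (0 < m))%:R * nb_value R d a m by [].
set f0 := nb_value R d a m in IHm *.
apply: le_trans (lerB_dist _ _); rewrite !normrM [ `|_%:R|]ger0_norm //.
have qd : (d - (0 < m))%:R * `|f0| <= d%:R * `|f0|.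
  by rewrite ler_wpM2r // ler_nat leq_subr.
have : d%:R * `|f0| <= `|a| ^+ 2 / 36 * `|f0| by apply: ler_wpM2r => //; lra.
have := ler_wpM2l a0 IHm.
rewrite expr2; have := mulr_ge0 a0 (normr_ge0 f1); lra.
Qed.

(** As [|a| / 2 >= 3], the values grow at least geometrically with ratio 3, so all earlier terms
    together are at most half of the last. *)
Lemma nb_value_sum_ge (R : realType) (d : nat) (a : R) (m : nat) :
    36 * d%:R <= a ^+ 2 -> (0 < d)%N ->
  (`|a| / 2) ^+ m / 2 <= `|\sum_(i < m.+1) nb_value R d a i|.
Proof.
move=> da d0.
have a6 : 6 <= `|a|.
  rewrite -(@ler_pXn2r _ 2) ?nnegrE // real_normK ?num_real //.
  apply: le_trans da; have : 1 <= d%:R :> R by rewrite ler1n.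
  rewrite expr2; lra.
have pow : (`|a| / 2) ^+ m <= `|nb_value R d a m|.
  elim: m => [|m IHm]; first by rewrite expr0 normr1.
  rewrite exprS; apply: le_trans (nb_value_growth _ _ _ m da d0).
  by apply: ler_wpM2l => //; rewrite divr_ge0.
have small : `|\sum_(i < m) nb_value R d a i| <= `|nb_value R d a m| / 2.
  elim: m {pow} => [|m IHm]; first by rewrite big_ord0 normr0 normr1; lra.
  rewrite big_ord_recr /=; apply: le_trans (ler_normD _ _) _.
  have := nb_value_growth _ _ _ m da d0.
  have := ler_wpM2r (normr_ge0 (nb_value R d a m)) a6; lra.
rewrite big_ord_recr /= addrC; apply: le_trans (lerB_normD _ _); lra.
Qed.

(** * Sizes of the graph and of the Moore bound *)

Lemma dk_graph_large (d k : nat) (T : finType) (e : rel T) :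
  dk_graph d k e -> (0 < k)%N -> (0 < d)%N -> (1 < #|T|)%N.
Proof.
move=> [sym_e irr_e reg_e _ diam_e] k0 d0.
have [x _|T0] := pickP T; last first.
  by move: k0; rewrite -diam_e /diameter big1 // => x; have := T0 x.
have : (0 < #|[set y | e x y]|)%N by rewrite reg_e.
move=> /card_gt0P[y]; rewrite inE => exy.
apply/card_gt1P; exists x, y; split=> //; apply: contraTneq exy => ->.
by rewrite irr_e.
Qed.

Lemma moore_bound_le (d k : nat) : (0 < d)%N ->
  (moore_bound d k <= k.+1 * d ^ k)%N.
Proof.
move=> d0; rewrite /moore_bound mulSn leq_add ?expn_gt0 ?d0 //.
rewrite big_distrr /= -[X in (_ <= X * _)%N]card_ord -sum_nat_const.
apply: leq_sum => i _; apply: (@leq_trans (d ^ i.+1)).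
  by rewrite expnS leq_mul2l; apply/orP; right; case: (i : nat) => // j; rewrite leq_exp2r // leq_subr.
by rewrite leq_pexp2l.
Qed.

(** * Walk matrices and the bound for one nontrivial eigenvalue *)

Section WalkMatrices.
Context {R : realType} {T : finType} (e : rel T) (d k : nat).
Hypothesis dk_e : dk_graph d k e.

Definition nb_mx (m : nat) : 'M[R]_#|T| :=
  \matrix_(i, j) (nb_walks e m (enum_val i) (enum_val j))%:R.

Lemma sum_enum_val (F : T -> nat) :
  \sum_(j < #|T|) (F (enum_val j))%:R = (\sum_x F x)%:R :> R.
Proof. by rewrite -natr_sum [in RHS](reindex _ (onW_bij _ (@enum_val_bij T))). Qed.

Lemma nb_mxSS m :
  nb_mx m.+1 *m adjmx R e = nb_mx m.+2 + (d - (0 < m))%:R *: nb_mx m.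
Proof.
have [sym_e _ reg_e _ _] := dk_e.
apply/matrixP => i j; rewrite !mxE -natrM -natrD.
rewrite -nb_walksSS // -sum_enum_val.
by apply: eq_bigr => l _; rewrite !mxE natrM.
Qed.

Lemma nb_mx_row_sum i :
  \sum_j (\sum_(m < k.+1) nb_mx m) i j = (moore_bound d k)%:R.
Proof.
have [sym_e _ reg_e _ _] := dk_e.
under eq_bigr => j _ do rewrite summxE.
rewrite exchange_big /=.
have row m : \sum_j nb_mx m i j = (\sum_z nb_walks e m (enum_val i) z)%:R.
  by rewrite -sum_enum_val; apply: eq_bigr => j _; rewrite mxE.
under eq_bigr => m _ do rewrite row.
rewrite -natr_sum big_ord_recl /= (bigD1 (enum_val i)) //= eqxx big1 => [|z].
  rewrite addn0 /moore_bound big_distrr /=; congr (_ + _)%:R.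
  by apply: eq_bigr => m _; exact: sum_nb_walks.
by rewrite eq_sym => /negPf ->.
Qed.

(** Any two vertices are joined by a walk of at most [k] edges, hence by a non-backtracking one that
    is no longer. *)
Lemma nb_mx_sum_ge1 i j : 1 <= (\sum_(m < k.+1) nb_mx m) i j.
Proof.
have [_ _ _ conn_e diam_e] := dk_e.
have [p [pP plast psize]] := walk_of_diameter _ _ _ _ (conn_e (enum_val i) (enum_val j)).
have [m mp] := walk_nb_walks e _ _ pP; rewrite plast => m0.
have mk : (m < k.+1)%N by rewrite ltnS -diam_e (leq_trans mp).
rewrite summxE (bigD1 (Ordinal mk)) //= mxE.
rewrite ler_wpDr ?ler1n // sumr_ge0 // => l _.
by rewrite mxE ler0n.
Qed.

Lemma nb_mx_eigen (v : 'rV_#|T|) (a : R) m :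
  v *m adjmx R e = a *: v -> v *m nb_mx m = nb_value R d a m *: v.
Proof.
move=> vA; have nb0 : nb_mx 0 = 1%:M.
  by apply/matrixP => i j; rewrite !mxE /= (inj_eq enum_val_inj).
have nb1 : nb_mx 1 = adjmx R e.
  apply/matrixP => i j; rewrite !mxE /= (bigD1 (enum_val i)) //= eqxx big1 ?addn0 //.
  by move=> y; rewrite eq_sym => /negPf ->.
suff: v *m nb_mx m = nb_value R d a m *: v /\
      v *m nb_mx m.+1 = nb_value R d a m.+1 *: v by case.
elim: m => [|m [IH0 IH1]]; first by rewrite nb0 nb1 mulmx1 scale1r.
split=> //; move/(canLR (addrK _)): (nb_mxSS m) => <-.
rewrite mulmxBr mulmxA IH1 -scalemxAl vA -scalemxAr IH0 !scalerA -scalerBl.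
by rewrite mulrC.
Qed.

Lemma adjmx_row_sum i : \sum_j adjmx R e i j = d%:R.
Proof.
have [_ _ reg_e _ _] := dk_e.
under eq_bigr => j _ do rewrite mxE.
by rewrite (sum_enum_val (fun y => e (enum_val i) y)) (sum_edges _ _ _ (reg_e _)).
Qed.

(* On vectors orthogonal to 1, \sum_(m < k.+1) nb_mx m acts like its difference
   with the all-ones matrix, which has nonnegative entries and small row sums. *)
Lemma nb_value_sum_le (v : 'rV_#|T|) (a : R) : v != 0 ->
    v *m adjmx R e = a *: v -> v *m (const_mx 1 : 'cV_#|T|) = 0 ->
  `|\sum_(m < k.+1) nb_value R d a m| <= (moore_bound d k)%:R - #|T|%:R.
Proof.
move=> v0 vA v1; pose P := \sum_(m < k.+1) nb_mx m.
apply: (eigenvalue_row_sum_bound _ _ (P - const_mx 1) _ _ v) => //.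
- move=> i j; rewrite [leRHS]mxE [X in _ + X]mxE [X in _ - X]mxE subr_ge0.
  exact: nb_mx_sum_ge1.
- move=> i; under eq_bigr => j _ do rewrite mxE [X in _ + X]mxE [X in _ - X]mxE.
  by rewrite big_split /= nb_mx_row_sum sumrN sumr_const card_ord.
rewrite mulmxBr mulmx_sumr scaler_suml.
have -> : v *m const_mx 1 = 0 :> 'rV_#|T|.
  apply/rowP => j; rewrite !mxE; move/matrixP/(_ 0 0): v1; rewrite !mxE => v1E.
  rewrite -[RHS]v1E.
  by apply: eq_bigr => i _; rewrite !mxE.
by rewrite subr0; apply: eq_bigr => m _; exact: nb_mx_eigen.
Qed.

(** Here [c] plays the role of [eps^(1/k)], so that only integer powers occur. *)
Lemma nontrivial_eigenvalue_bound (v : 'rV_#|T|) (a c : R) :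
    (0 < k)%N -> (0 < d)%N -> v != 0 ->
    v *m adjmx R e = a *: v -> v *m (const_mx 1 : 'cV_#|T|) = 0 ->
    0 < c -> 1 <= c ^+ 2 * d%:R ->
    (1 - c ^+ k) * (moore_bound d k)%:R <= #|T|%:R ->
  `|a| <= 4 * k.+1%:R * c * d%:R.
Proof.
move=> k0 d0 v0 vA v1 c0 cd hn.
have dR : 0 < d%:R :> R by rewrite ltr0n.
have cdR : 0 < c * d%:R by rewrite mulr_gt0.
have k2 : 2 <= k.+1%:R :> R by rewrite ler_nat.
rewrite -mulrA; have [ad|ad] := lerP (a ^+ 2) (36 * d%:R).
  (* [36 d <= 36 c^2 d^2], and [6 <= 4 (k + 1)] because [k >= 1]. *)
  apply: (@le_trans _ _ (6 * (c * d%:R))); last by rewrite ler_pM2r //; lra.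
  rewrite -(@ler_pXn2r _ 2) ?nnegrE ?real_normK ?num_real //; last lra.
  apply: (le_trans ad); rewrite !exprMn [d%:R ^+ 2]expr2.
  have := ler_wpM2r (ltW dR) cd; rewrite mul1r; lra.
have := nb_value_sum_ge R d a k (ltW ad) d0.
have := nb_value_sum_le v a v0 vA v1.
move=> /[swap] /le_trans /[apply] low.
have mu : (moore_bound d k)%:R <= k.+1%:R * d%:R ^+ k :> R.
  by rewrite -natrX -natrM ler_nat moore_bound_le.
have {mu} := ler_wpM2l (exprn_ge0 k (ltW c0)) mu.
rewrite mulrCA -exprMn => mu.
have {}low : (`|a| / 2) ^+ k <= 2 * k.+1%:R * (c * d%:R) ^+ k.
  move: hn low mu; lra.
(* The factor [2 (k + 1)] is at least 1, so it may be replaced by its [k]-th power; then [k]-th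
   roots can be taken. *)
have {}low : (`|a| / 2) ^+ k <= (2 * k.+1%:R * (c * d%:R)) ^+ k.
  apply: le_trans low _; rewrite [leRHS]exprMn ler_pM2r ?exprn_gt0 //.
  by rewrite -[leLHS]expr1 ler_weXn2l //; lra.
rewrite ler_pXn2r ?nnegrE ?divr_ge0 ?mulr_ge0 ?(ltW c0) // in low.
lra.
Qed.

End WalkMatrices.

(** * The constant [4 (k + 1)] and both ends of the spectrum *)

Theorem theorem3p4 (R : realType) (k : nat) (hk : (0 < k)%N) :
  exists C : R,
    forall (d : nat) (eps : R) (T : finType) (e : rel T) (s : seq R),
      0 < eps ->
      eps `^ (- (2 / k%:R)) <= d%:R ->
      dk_graph d k e ->
      (1 - eps) * (moore_bound d k)%:R <= #|T|%:R ->
      is_spectrum (adjmx R e) s ->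
      graph_lambda s <= C * eps `^ (k%:R^-1) * d%:R.
Proof.
exists (4 * k.+1%:R) => d eps T e s eps0 hd dk_e hn spec_s.
pose c := eps `^ k%:R^-1; rewrite -/c.
have k0 : k%:R != 0 :> R by rewrite pnatr_eq0 -lt0n.
have c0 : 0 < c by exact: powR_gt0.
have ck : c ^+ k = eps.
  by rewrite -powR_mulrn ?(ltW c0) // -powRrM mulVf // powRr1 ?(ltW eps0).
have cd : 1 <= c ^+ 2 * d%:R.
  have <- : eps `^ (2 / k%:R) = c ^+ 2.
    by rewrite -powR_mulrn ?(ltW c0) // -powRrM mulrC.
  by rewrite mulrC -ler_pdivrMr ?powR_gt0 // mul1r -powRN.
have d0 : (0 < d)%N.
  by rewrite lt0n; apply: contraTneq cd => ->; rewrite mulr0 ler10.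
(* With two vertices or more, the indices 1 and [(size s).-1] are positive and in range, so neither
   entry is a default value or the trivial eigenvalue at index 0. *)
have n1 := dk_graph_large _ _ _ _ dk_e hk d0.
have sz : size s = #|T|.
  apply/eqP; rewrite -eqSS -(size_char_poly (adjmx R e)) (proj2 spec_s).
  by rewrite size_prod_XsubC.
have A1 : adjmx R e *m const_mx 1 = d%:R *: (const_mx 1 : 'cV_#|T|).
  apply/colP => i; rewrite !mxE mulr1 -(adjmx_row_sum e d k dk_e i).
  by apply: eq_bigr => j _; rewrite !mxE mulr1.
have leA a : eigenvalue (adjmx R e) a -> a <= d%:R.
  move=> /eigenvalueP[v vA v0]; apply: le_trans (ler_norm a) _.
  apply: (eigenvalue_row_sum_bound _ _ (adjmx R e) _ _ v) => // i *.
    by rewrite mxE ler0n.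
  by rewrite (adjmx_row_sum e d k dk_e).
have bound i : (0 < i < size s)%N -> `|s`_i| <= 4 * k.+1%:R * c * d%:R.
  move=> si; have [v [v0 vA v1]] := spectrum_tail_eigenvector _ _ _ _ _ _ spec_s A1 leA si.
  by apply: (nontrivial_eigenvalue_bound _ _ _ dk_e v); rewrite ?ck.
rewrite /graph_lambda ge_max !bound // sz ?n1 //.
by case: #|T| n1 => [|[|n]] //= _.
Qed.
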